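(* Assume $0<\theta<1$. For every $\varepsilon>0$ with $1/\varepsilon>r\bar x+y_2$ let $\underline V^\varepsilon$ denote the minimal solution of the regularized discrete HJB system (R$_\varepsilon$). If $\varepsilon>\varepsilon'>0$ (with $1/\varepsilon>r\bar x+y_2$), then $\underline V^{\varepsilon}\preceq\underline V^{\varepsilon'}$. Moreover, as $\varepsilon\to0$, $\underline V^{\varepsilon}$ converges uniformly on the grid $\mathcal G^{\Delta x}=\{x_0,\dots,x_I\}$ to the minimal solution of the discrete HJB system (D).
   Context: Parameters: $\gamma>1$, $0<\psi<1$, $\rho>r>0$, $y_2>y_1>0$, $\lambda_1,\lambda_2>0$, and $\underline x$ with $\rho\underline x+y_1>0$. Set $\theta=\frac{1-\psi^{-1}}{1-\gamma}>0$, $b=\rho\left[\frac{r+\psi(\rho-r)}{\rho}\right]^{\frac1{1-\psi}}$, and $\bar\jmath=3-j$ for $j\in\{1,2\}$. For $c>0$, $v<0$: $\mathcal F(c,v)=\frac{\rho}{1-\psi^{-1}}\,c^{1-\psi^{-1}}\,((1-\gamma)v)^{1-\theta}$. For $v<0$ and $rx+y>0$: $H(x,y,v,p)=(rx+y)p+\frac{\rho^\psi}{\psi-1}p^{1-\psi}((1-\gamma)v)^{\frac{1-\gamma\psi}{1-\gamma}}$ if $p\ge0$, and $H=+\infty$ if $p<0$. Grid: $\underline x\le 0<\bar x$, $I\ge 1$ an integer, $\Delta x=(\bar x-\underline x)/I$, $x_i=\underline x+i\Delta x$ for $0\le i\le I$. A grid function is $V=(V_{i,j})_{0\le i\le I,\,j\in\{1,2\}}$;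 $U\preceq V$ means $U_{i,j}\le V_{i,j}$ for all $i,j$. $\Delta^+V_{i,j}=(V_{i+1,j}-V_{i,j})/\Delta x$ for $i<I$, $\Delta^-V_{i,j}=(V_{i,j}-V_{i-1,j})/\Delta x$ for $i>0$ (the values of $\Delta^+V_{I,j}$, $\Delta^-V_{0,j}$ are arbitrary and play no role). Put $\bar c_j(x)=rx+y_j$, $(z)_+=\max(z,0)$, $0^{-\psi}=+\infty$. Discrete Hamiltonian: for $v<0$ let $p_{\min}(x,y,v)=\rho(rx+y)^{-1/\psi}((1-\gamma)v)^{1-\theta}$ be the minimizer of $H(x,y,v,\cdot)$ and $H_{\min}(x,y,v)=\min_pH(x,y,v,p)$. $H^\uparrow(x,y,v,p)=H(x,y,v,p)$ if $p\ge p_{\min}(x,y,v)$ and $H_{\min}(x,y,v)$ if $p<p_{\min}(x,y,v)$. $H^\downarrow(x,y,v,p)=H(x,y,v,p)$ if $0\le p\le p_{\min}(x,y,v)$, $H_{\min}(x,y,v)$ if $p>p_{\min}(x,y,v)$, $+\infty$ if $p<0$. $\boldsymbol H(x_i,y_j,v,p^F,p^B)$ equals $H^\uparrow(x_i,y_j,v,p^F)$ if $i=0$; $H^\uparrow(x_i,y_j,v,p^F)+H^\downarrow(x_i,y_j,v,p^B)-H_{\min}(x_i,y_j,v)$ if $0<i<I$; $H^\downarrow(x_i,y_j,v,p^B)$ if $i=I$. Regularized Hamiltonian: for $v<0$ and reals $p^F,p^B$ let $c^F=\min\{\rho^\psi(p^F)_+^{-\psi}((1-\gamma)v)^{\frac{1-\gamma\psi}{1-\gamma}},\bar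 c_j(x_i)\}$ for $i<I$, $c^F=\bar c_j(\bar x)$ for $i=I$; $c^B=\max\{\min\{1/\varepsilon,\rho^\psi(p^B)_+^{-\psi}((1-\gamma)v)^{\frac{1-\gamma\psi}{1-\gamma}}\},\bar c_j(x_i)\}$ for $i>0$, $c^B=\bar c_j(\underline x)$ for $i=0$; and $$\boldsymbol H_\varepsilon(x_i,y_j,v,p^F,p^B)=(\bar c_j(x_i)-c^F)p^F+(\bar c_j(x_i)-c^B)p^B+\mathcal F(c^F,v)+\mathcal F(c^B,v)-\mathcal F(\bar c_j(x_i),v).$$ System (D): $\frac\rho\theta V_{i,j}=\boldsymbol H(x_i,y_j,V_{i,j},\Delta^+V_{i,j},\Delta^-V_{i,j})+\lambda_j(V_{i,\bar\jmath}-V_{i,j})$ for all $i,j$. System (R$_\varepsilon$): the same with $\boldsymbol H_\varepsilon$ in place of $\boldsymbol H$. Barriers: $\check U_{i,1}=\check U_{i,2}=\frac{(rx_i+y_1)^{1-\gamma}}{1-\gamma}$, $\check V_{i,1}=\check V_{i,2}=\frac{(b(x_i+y_2/r))^{1-\gamma}}{1-\gamma}$. A solution of (R$_\varepsilon$) (resp. (D)) is a grid function $V$ satisfying the equations and $\check U\preceq V\preceq\check V$; the minimal solution is the solution that is $\preceq$ every solution. *)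

(* Defs.v *)
From HB Require Import structures.
From mathcomp Require Import all_boot all_order all_algebra.
From mathcomp Require Import all_classical all_reals all_analysis.

Set Implicit Arguments.
Unset Strict Implicit.
Unset Printing Implicit Defensive.

Import Order.TTheory GRing.Theory Num.Theory.
Import numFieldNormedType.Exports.

Local Open Scope ring_scope.

(* The two income states j = 1, 2 are encoded by ord0, ord_max : 'I_2, so that
   rev_ord j is the other state 3 - j. *)
Record params (R : realType) := Params {
  gamma : R;
  psi : R;
  rho : R;
  rate : R;            (* the interest rate r *)
  income : 'I_2 -> R;  (* y_1, y_2 *)
  lambda : 'I_2 -> R;  (* lambda_1, lambda_2 *)
  xmin : R;
  xmax : R }.

Record standing (R : realType) (P : params R) : Prop := Standing {
  gamma_gt1 : 1 < gamma P;
  psi_gt0 : 0 < psi P;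
  psi_lt1 : psi P < 1;
  rate_gt0 : 0 < rate P;
  rate_lt_rho : rate P < rho P;
  income1_gt0 : 0 < income P ord0;
  income1_lt2 : income P ord0 < income P ord_max;
  lambda_gt0 : forall j, 0 < lambda P j;
  xmin_borrow : 0 < rho P * xmin P + income P ord0;
  xmin_le0 : xmin P <= 0;
  xmax_gt0 : 0 < xmax P }.

Section Model.
Variables (R : realType) (P : params R).
Implicit Types x y v p c z a : R.

Local Notation gamma := (gamma P).
Local Notation psi := (psi P).
Local Notation rho := (rho P).
Local Notation r := (rate P).
Local Notation income := (income P).
Local Notation lambda := (lambda P).
Local Notation xmin := (xmin P).
Local Notation xmax := (xmax P).

Definition theta : R := (1 - psi^-1) / (1 - gamma).

Definition bcoef : R :=
  rho * ((r + psi * (rho - r)) / rho) `^ (1 / (1 - psi)).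

Definition aggregator c v : R :=
  rho / (1 - psi^-1) * c `^ (1 - psi^-1) * ((1 - gamma) * v) `^ (1 - theta).

Definition Ham x y v p : \bar R :=
  if p < 0 then +oo%E
  else ((r * x + y) * p
        + rho `^ psi / (psi - 1) * p `^ (1 - psi)
          * ((1 - gamma) * v) `^ ((1 - gamma * psi) / (1 - gamma)))%:E.

Definition pmin x y v : R :=
  rho * (r * x + y) `^ (- psi^-1) * ((1 - gamma) * v) `^ (1 - theta).

Definition Hmin x y v : \bar R := ereal_inf (range (Ham x y v)).

Definition Hup x y v p : \bar R :=
  if pmin x y v <= p then Ham x y v p else Hmin x y v.

Definition Hdown x y v p : \bar R :=
  if p < 0 then +oo%E
  else if p <= pmin x y v then Ham x y v p else Hmin x y v.

(* The power z ^ (- a) for z >= 0 and a > 0, with 0 ^ (- a) = +oo; the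
   library's powR gives 0 `^ (- a) = 0 instead. *)
Definition negpow z a : \bar R :=
  if z == 0 then +oo%E else (z `^ (- a))%:E.

(* first-order consumption, infinite when p <= 0 *)
Definition cstar v p : \bar R :=
  ((rho `^ psi)%R%:E * negpow (Num.max p 0)%R psi
   * (((1 - gamma) * v) `^ ((1 - gamma * psi) / (1 - gamma)))%R%:E)%E.

(* The grid x_0, ..., x_n has n cells (n stands for the integer I); a grid
   function is an (n + 1) x 2 matrix, whose library topology is that of the
   sup distance over all entries, i.e. uniform convergence on the grid. *)
Variable n : nat.
Local Notation gridfun := 'M[R]_(n.+1, 2).
Implicit Types (U V : gridfun) (i : 'I_n.+1) (j : 'I_2).

Definition dx : R := (xmax - xmin) / n%:R.
Definition xgrid i : R := xmin + i%:R * dx.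
Definition cbar j x : R := r * x + income j.

Definition preceq U V : Prop := forall i j, U i j <= V i j.

(* Dplus at i = n and Dminus at i = 0 are junk values: the Hamiltonians below
   do not depend on them. *)
Definition Dplus V i j : R := (V (inord i.+1) j - V i j) / dx.
Definition Dminus V i j : R := (V i j - V (inord i.-1) j) / dx.

Definition Hbold i j v pF pB : \bar R :=
  let x := xgrid i in let y := income j in
  if i == ord0 then Hup x y v pF
  else if i == ord_max then Hdown x y v pB
  else (Hup x y v pF + Hdown x y v pB - Hmin x y v)%E.

(* [fine] is only applied to minima of a positive extended real and a
   positive real, which are finite. *)
Definition cF i j v pF : R :=
  if i == ord_max then cbar j (xgrid i)
  else fine (Order.min (cstar v pF) (cbar j (xgrid i))%:E).

Definition cB (e : R) i j v pB : R :=
  if i == ord0 then cbar j (xgrid i)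
  else Num.max (fine (Order.min (1 / e)%:E (cstar v pB))) (cbar j (xgrid i)).

Definition Hreg (e : R) i j v pF pB : R :=
  let c0 := cbar j (xgrid i) in
  let c1 := cF i j v pF in
  let c2 := cB e i j v pB in
  (c0 - c1) * pF + (c0 - c2) * pB
  + aggregator c1 v + aggregator c2 v - aggregator c0 v.

Definition systemD V : Prop := forall i j,
  (rho / theta * V i j)%:E =
  (Hbold i j (V i j) (Dplus V i j) (Dminus V i j)
   + (lambda j * (V i (rev_ord j) - V i j))%R%:E)%E.

Definition systemR (e : R) V : Prop := forall i j,
  rho / theta * V i j =
  Hreg e i j (V i j) (Dplus V i j) (Dminus V i j)
  + lambda j * (V i (rev_ord j) - V i j).

Definition Ulow : gridfun :=
  \matrix_(i, j) ((r * xgrid i + income ord0) `^ (1 - gamma) / (1 - gamma)).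

Definition Vhigh : gridfun :=
  \matrix_(i, j)
    ((bcoef * (xgrid i + income ord_max / r)) `^ (1 - gamma) / (1 - gamma)).

Definition solution (S : gridfun -> Prop) V : Prop :=
  [/\ S V, preceq Ulow V & preceq V Vhigh].

Definition minimal_solution (S : gridfun -> Prop) V : Prop :=
  solution S V /\ forall W, solution S W -> preceq V W.

Definition admissible (e : R) : Prop :=
  0 < e /\ r * xmax + income ord_max < 1 / e.

End Model.

(* Main.v *)
(* For fixed controls (c1, c2) with c1 <= cbar <= c2, the function
     (cbar - c1) D^+V + (cbar - c2) D^-V + F(c1, v) + F(c2, v) - F(cbar, v)
   is nondecreasing in V after adding a multiple of v (here theta < 1 is used),
   the discrete Hamiltonian of (D) is its supremum over all controls, and that
   of (R_eps) its maximum over the controls with c2 <= 1/eps.  Tarski's theorem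
   on the order interval between the barriers therefore yields a least solution
   of (R_eps), which lies below every supersolution; since the Hamiltonians
   increase as eps decreases, so do the least solutions, and they stay below
   every solution of (D).  Their limit is a supersolution of (D) by passing to
   the limit for fixed controls.  For the converse inequality the only danger is
   that D^-V^eps approaches 0 from below, with (cbar - 1/eps) D^-V^eps tending to
   a positive number; this is excluded because the least solution of (R_eps) is
   nondecreasing in wealth. *)
Require Import Defs.
From HB Require Import structures.
From mathcomp Require Import all_boot all_order all_algebra.
From mathcomp Require Import all_classical all_reals all_analysis.
From mathcomp Require Import ring lra.

Set Implicit Arguments.
Unset Strict Implicit.
Unset Printing Implicit Defensive.

Import Order.TTheory GRing.Theory Num.Theory.
Import numFieldNormedType.Exports.

Local Open Scope classical_set_scope.
Local Open Scope ring_scope.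

(** * Power inequalities from the convexity of the exponential *)

Section Powers.
Variable R : realType.
Implicit Types a c d q t : R.

Lemma powR_expR a q : 0 < a -> a `^ q = expR (q * ln a).
Proof. by move=> a0; rewrite /powR gt_eqF. Qed.

Lemma ler_ln_pos a c : 0 < a -> 0 < c -> (ln a <= ln c) = (a <= c).
Proof. by move=> a0 c0; rewrite -ler_expR !lnK ?posrE. Qed.

(** Bernoulli's inequality for negative exponents: bound [expR (q * ln t)] to first order, then use
    ln t <= t - 1 with [q < 0]. *)
Lemma powR_ge_linear t q : 0 < t -> q < 0 -> 1 + q * (t - 1) <= t `^ q.
Proof.
move=> t0 q0; rewrite powR_expR //.
apply: le_trans (expR_ge1Dx _); rewrite lerD2l ler_nM2l //.
have := expR_ge1Dx (ln t); rewrite lnK ?posrE //. lra.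
Qed.

(** Concavity of c^q / q; homogeneity reduces it to Bernoulli's inequality at [c / d]. *)
Lemma powR_tangent c d q : 0 < c -> 0 < d -> q < 0 ->
  c `^ q / q <= d `^ q / q + d `^ (q - 1) * (c - d).
Proof.
move=> c0 d0 q0.
have cd0 : 0 < c / d by rewrite divr_gt0.
have -> : c `^ q = d `^ q * (c / d) `^ q.
  by rewrite -powRM ?ltW// mulrC divfK ?gt_eqF.
have -> : d `^ (q - 1) = d `^ q / d.
  by rewrite powRB ?powRr1 ?ltW//; apply/implyP => _; rewrite gt_eqF.
have -> : d `^ q / q + d `^ q / d * (c - d) =
          d `^ q * (1 + q * (c / d - 1)) / q by field; rewrite lt_eqF// gt_eqF.
rewrite ler_nM2r ?invr_lt0// ler_wpM2l ?powR_ge0//.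
exact: powR_ge_linear.
Qed.

(** Weighted arithmetic-geometric mean inequality for 1 and t. With w the arithmetic mean, the
    bounds ln s <= s - 1 at 1 / w and t / w, weighted by 1 - q and q, have right-hand sides that
    cancel. *)
Lemma powR_le_linear t q : 0 < t -> 0 <= q <= 1 -> t `^ q <= 1 - q + q * t.
Proof.
move=> t0 /andP[q0 q1].
have w0 : 0 < 1 - q + q * t.
  have [->|qn0] := eqVneq q 0; first lra.
  have : 0 < q * t by rewrite mulr_gt0// lt_neqAle eq_sym qn0.
  lra.
rewrite powR_expR// -[leRHS]lnK ?posrE// ler_expR.
have lnle a : 0 < a -> ln a <= a - 1.
  by move=> a0; have := expR_ge1Dx (ln a); rewrite lnK ?posrE //; lra.
have H1 := lnle (1 / (1 - q + q * t)) (divr_gt0 ltr01 w0).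
have H2 := lnle (t / (1 - q + q * t)) (divr_gt0 t0 w0).
rewrite ln_div ?posrE// ln1 in H1; rewrite ln_div ?posrE// in H2.
set w := 1 - q + q * t in w0 H1 H2 *.
have /(ler_wpM2l q0) H3 := H2.
have : 0 <= 1 - q by lra.
move=> /ler_wpM2l /(_ _ _ H1) H4.
have E : (1 - q) * (1 / w - 1) + q * (t / w - 1) = 0.
  have -> : (1 - q) * (1 / w - 1) + q * (t / w - 1) = (1 - q + q * t) / w - 1.
    by ring.
  by rewrite divff ?subrr// gt_eqF.
lra.
Qed.

End Powers.

(** * Control form of the Hamiltonians *)

Section Prices.
Variables (R : realType) (P : params R).
Hypothesis hP : standing P.
Hypothesis htheta : 0 < theta P /\ theta P < 1.
Implicit Types x y v p c d e : R.

Local Notation gamma := (gamma P).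
Local Notation psi := (psi P).
Local Notation rho := (rho P).
Local Notation r := (rate P).
Local Notation theta := (theta P).
Local Notation q := (1 - psi^-1).
Local Notation F := (aggregator P).

Let gamma1 : 1 < gamma := gamma_gt1 hP.
Let psi0 : 0 < psi := psi_gt0 hP.
Let psi1 : psi < 1 := psi_lt1 hP.

Lemma rho_gt0 : 0 < rho.
Proof. exact: lt_trans (rate_gt0 hP) (rate_lt_rho hP). Qed.

Lemma eis_exponent_lt0 : q < 0.
Proof. by rewrite subr_lt0 invf_gt1. Qed.

Lemma theta_mul : theta * (1 - gamma) = q.
Proof. by rewrite /Defs.theta divfK// subr_eq0 lt_eqF. Qed.

Lemma value_exponentE : (1 - gamma * psi) / (1 - gamma) = psi * (1 - theta).
Proof.
have g0 : 1 - gamma != 0 by rewrite subr_eq0 lt_eqF.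
by rewrite /Defs.theta; field; rewrite g0 gt_eqF.
Qed.

Lemma scaled_gt0 v : v < 0 -> 0 < (1 - gamma) * v.
Proof. by move=> v0; rewrite nmulr_rgt0// subr_lt0. Qed.

(* The marginal value of consumption, that is, the derivative of F in c. *)
Definition marg c v : R :=
  rho * c `^ (- psi^-1) * ((1 - gamma) * v) `^ (1 - theta).

Lemma marg_gt0 c v : 0 < c -> v < 0 -> 0 < marg c v.
Proof. by move=> c0 v0; rewrite !mulr_gt0 ?rho_gt0 ?powR_gt0 ?scaled_gt0. Qed.

Lemma marg_le c d v : v < 0 -> 0 < c -> 0 < d ->
  (marg d v <= marg c v) = (c <= d).
Proof.
move=> v0 c0 d0; rewrite /marg ler_pM2r ?powR_gt0 ?scaled_gt0//.
rewrite ler_pM2l ?rho_gt0// !powR_expR// ler_expR !mulNr lerN2.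
rewrite ler_pM2l ?invr_gt0//. exact: ler_ln_pos.
Qed.

(** Euler's identity: F is homogeneous of degree [1 - psi^-1] in c. *)
Lemma aggregator_marg c v : 0 < c -> F c v = marg c v * c / q.
Proof.
move=> c0; have Ec : c `^ q = c `^ (- psi^-1) * c.
  by rewrite powRD ?powRr1 ?ltW// 1?mulrC//; apply/implyP => _; rewrite gt_eqF.
by rewrite /aggregator /marg Ec; ring.
Qed.

Lemma aggregator_tangent c d v : 0 < c -> 0 < d ->
  F c v <= F d v + marg d v * (c - d).
Proof.
move=> c0 d0; rewrite /aggregator /marg.
have := powR_tangent c0 d0 eis_exponent_lt0.
have -> : q - 1 = - psi^-1 by ring.
set k := _ `^ (1 - theta) => /(ler_wpM2l (ltW rho_gt0)).
have k0 : 0 <= k by exact: powR_ge0.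
by move=> /(ler_wpM2r k0); congr (_ <= _); ring.
Qed.

Lemma aggregator_lt0 c v : 0 < c -> v < 0 -> F c v < 0.
Proof.
move=> c0 v0; rewrite /aggregator pmulr_llt0 ?powR_gt0 ?scaled_gt0//.
by rewrite pmulr_llt0 ?powR_gt0// pmulr_rlt0 ?rho_gt0// invr_lt0 eis_exponent_lt0.
Qed.

Lemma aggregator_homo_c c d v : 0 < c -> c <= d -> F c v <= F d v.
Proof.
move=> c0 cd; have d0 := lt_le_trans c0 cd.
rewrite /aggregator ler_wpM2r ?powR_ge0// -!mulrA ler_wpM2l ?(ltW rho_gt0)//.
rewrite ler_nM2l ?invr_lt0 ?eis_exponent_lt0// !powR_expR// ler_expR.
by rewrite ler_nM2l ?eis_exponent_lt0// ler_ln_pos.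
Qed.

(** The base decreases in the value because gamma > 1, and theta < 1 makes the exponent
    nonnegative. *)
Lemma value_power_anti v w : v <= w -> w < 0 ->
  ((1 - gamma) * w) `^ (1 - theta) <= ((1 - gamma) * v) `^ (1 - theta).
Proof.
move=> vw w0; have v0 := le_lt_trans vw w0.
apply: ge0_ler_powR; rewrite ?nnegrE ?subr_ge0 ?(ltW (scaled_gt0 _))//.
  by rewrite ltW //; case: htheta.
by rewrite ler_nM2l// subr_lt0.
Qed.

Lemma aggregator_homo_v c v w : 0 < c -> v <= w -> w < 0 -> F c v <= F c w.
Proof.
move=> c0 vw w0; rewrite /aggregator ler_wnM2l ?value_power_anti//.
rewrite mulr_le0_ge0 ?powR_ge0// mulr_ge0_le0 ?(ltW rho_gt0)//.
by rewrite invr_le0 ltW// eis_exponent_lt0.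
Qed.

Lemma aggregator_diff_homo_v c d v w : 0 < c -> c <= d -> v <= w -> w < 0 ->
  F c v - F d v <= F c w - F d w.
Proof.
(* At the value [(1 - gamma)^-1] the power factor is 1, so this instance gives the sign of the
   coefficient difference. *)
move=> c0 cd vw w0; have := aggregator_homo_c 
  ((1 - gamma)^-1) c0 cd.
rewrite /aggregator -!mulrBl divff ?subr_eq0 ?lt_eqF// powR1 !mulr1.
by rewrite -subr_le0 => h; rewrite ler_wnM2l// value_power_anti.
Qed.

Lemma aggregator_cvg0 v eta : v < 0 -> 0 < eta ->
  exists c, 0 < c /\ forall d, c <= d -> - eta <= F d v.
Proof.
move=> v0 eta0.
set A := rho / - q * ((1 - gamma) * v) `^ (1 - theta).
have A0 : 0 < A.
  by rewrite mulr_gt0 ?powR_gt0 ?scaled_gt0// divr_gt0 ?rho_gt0// oppr_gt0 eis_exponent_lt0.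
have EF c : F c v = - (A * c `^ q).
  have := eis_exponent_lt0; rewrite /aggregator /A.
  by move: (1 - psi^-1) => k k0; field; rewrite lt_eqF.
pose c := (eta / A) `^ q^-1.
have c0 : 0 < c by rewrite powR_gt0// divr_gt0.
have Fc : F c v = - eta.
  rewrite EF /c -powRrM mulVf ?lt_eqF ?eis_exponent_lt0// powRr1 ?divr_ge0 ?ltW//.
  by rewrite mulrC divfK// gt_eqF.
exists c; split=> // d cd; rewrite -Fc; exact: aggregator_homo_c.
Qed.

(** The inverse of [marg] in its first argument, which is the real value of [cstar] at a positive
    price. *)
Definition consumption v p : R :=
  rho `^ psi * p `^ (- psi) * ((1 - gamma) * v) `^ ((1 - gamma * psi) / (1 - gamma)).

Lemma consumption_gt0 v p : 0 < p -> v < 0 -> 0 < consumption v p.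
Proof. by move=> ? ?; rewrite !mulr_gt0 ?powR_gt0 ?rho_gt0 ?scaled_gt0. Qed.

Lemma marg_consumption v p : 0 < p -> v < 0 -> marg (consumption v p) v = p.
Proof.
move=> p0 v0; rewrite /marg /consumption value_exponentE.
have := scaled_gt0 v0; move: ((1 - gamma) * v) => m m0.
rewrite !powRM ?mulr_ge0 ?powR_ge0// -!powRrM.
have -> : psi * - psi^-1 = - 1 by field; rewrite gt_eqF.
have -> : - psi * - psi^-1 = 1 by field; rewrite gt_eqF.
have -> : psi * (1 - theta) * - psi^-1 = - (1 - theta) by field; rewrite gt_eqF.
rewrite !powRN !powRr1 ?ltW ?rho_gt0//.
by field; rewrite !gt_eqF ?powR_gt0 ?rho_gt0.
Qed.

Lemma consumption_le v p c : 0 < p -> v < 0 -> 0 < c ->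
  (consumption v p <= c) = (marg c v <= p).
Proof.
move=> p0 v0 c0.
by rewrite -[p in RHS](marg_consumption p0 v0) marg_le ?consumption_gt0.
Qed.

Lemma cstar_pos v p : 0 < p -> cstar P v p = (consumption v p)%:E.
Proof. by move=> p0; rewrite /cstar max_l ?ltW// /negpow gt_eqF. Qed.

Lemma cstar_npos v p : p <= 0 -> v < 0 -> cstar P v p = +oo%E.
Proof.
move=> p0 v0; rewrite /cstar max_r// /negpow eqxx.
by rewrite gt0_muley ?lte_fin ?powR_gt0 ?rho_gt0// gt0_mulye ?lte_fin ?powR_gt0 ?scaled_gt0.
Qed.

(* The control form of the Hamiltonians: the discrete Hamiltonians are the
   suprema of [gain] over c <= c0 (forward) and c >= c0 (backward). *)
Definition gain c0 v p c : R := (c0 - c) * p + F c v.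

Lemma gain_tangent c0 v p c d : 0 < c -> 0 < d ->
  gain c0 v p c <= gain c0 v p d + (marg d v - p) * (c - d).
Proof.
move=> c0' d0; rewrite /gain; have := aggregator_tangent v c0' d0; nra.
Qed.

(** The gain is concave with slope [marg d v - p] at d. Either its stationary point lies below c0
    and is optimal, or the slope at c0 is nonnegative and c0 is optimal. *)
Lemma forward_argmax c0 v p : 0 < c0 -> v < 0 ->
  let d := fine (Order.min (cstar P v p) c0%:E) in
  [/\ 0 < d, d <= c0 & forall c, 0 < c -> c <= c0 -> gain c0 v p c <= gain c0 v p d].
Proof.
move=> hc0 v0; cbn zeta.
have at_c0 : p <= marg c0 v ->
    forall c, 0 < c -> c <= c0 -> gain c0 v p c <= gain c0 v p c0.
  move=> pm c c_gt0 cc0; apply: (le_trans (gain_tangent _ _ _ c_gt0 hc0)).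
  by rewrite gerDl mulr_ge0_le0 ?subr_ge0 ?subr_le0.
have [p0|p0] := leP p 0.
  rewrite cstar_npos// min_r ?leey//=; split=> //; apply: at_c0.
  exact: le_trans p0 (ltW (marg_gt0 _ _)).
rewrite cstar_pos//; have cs0 := consumption_gt0 p0 v0.
have [cc|cc] := leP (consumption v p) c0.
  rewrite min_l ?lee_fin//=; split=> // c c_gt0 _.
  have := gain_tangent c0 v p c_gt0 cs0.
  by rewrite marg_consumption// subrr mul0r addr0.
rewrite min_r ?lee_fin/=; last exact: ltW.
split=> //; apply: at_c0.
by rewrite ltW// ltNge -consumption_le// -ltNge.
Qed.

(** The same concavity argument on [c0, C]: the maximizer is the projection of the stationary point,
    which is infinite for p <= 0. *)
Lemma backward_argmax c0 C v p : 0 < c0 -> c0 < C -> v < 0 ->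
  let d := Num.max (fine (Order.min C%:E (cstar P v p))) c0 in
  [/\ c0 <= d, d <= C & forall c, c0 <= c -> c <= C -> gain c0 v p c <= gain c0 v p d].
Proof.
move=> hc0 hC v0; cbn zeta; have C0 := lt_trans hc0 hC.
have at_C : p <= marg C v ->
    forall c, c0 <= c -> c <= C -> gain c0 v p c <= gain c0 v p C.
  move=> pm c c0c cC.
  apply: (le_trans (gain_tangent _ _ _ (lt_le_trans hc0 c0c) C0)).
  by rewrite gerDl mulr_ge0_le0 ?subr_ge0 ?subr_le0.
have [p0|p0] := leP p 0.
  rewrite cstar_npos// min_l ?leey//= max_l; last exact: ltW.
  split=> //; first exact: ltW.
  apply: at_C; exact: le_trans p0 (ltW (marg_gt0 _ _)).
rewrite cstar_pos//; have cs0 := consumption_gt0 p0 v0.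
have [Ccs|csC] := leP C (consumption v p).
  rewrite min_l ?lee_fin//= max_l; last exact: ltW.
  split=> //; first exact: ltW.
  by apply: at_C; rewrite -[p](marg_consumption p0 v0) marg_le.
rewrite min_r ?lee_fin/=; last exact: ltW.
have [cc|cc] := leP c0 (consumption v p).
  split=> //; first exact: ltW.
  move=> c c0c _; have := gain_tangent c0 v p (lt_le_trans hc0 c0c) cs0.
  by rewrite marg_consumption// subrr mul0r addr0.
split=> //; first exact: ltW.
move=> c c0c _; apply: (le_trans (gain_tangent _ _ _ (lt_le_trans hc0 c0c) hc0)).
rewrite gerDl mulr_le0_ge0 ?subr_ge0 ?subr_le0//.
by rewrite -consumption_le// ltW.
Qed.

(** Legendre duality: the stationary consumption has marginal value p, and Euler's identity turns
    its gain into the closed formula of [Ham]. *)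
Lemma Ham_pos x y v p : 0 < p -> v < 0 ->
  Ham P x y v p = (gain (r * x + y) v p (consumption v p))%:E.
Proof.
move=> p0 v0; rewrite /Ham ltNge ltW//=; congr (_%:E).
have cs0 := consumption_gt0 p0 v0; set c := consumption v p in cs0 *.
have -> : gain (r * x + y) v p c = (r * x + y) * p + (F c v - c * p).
  by rewrite /gain; ring.
congr (_ + _).
rewrite aggregator_marg// marg_consumption// /c /consumption.
have Ep : p `^ (1 - psi) = p * p `^ (- psi).
  by rewrite powRD ?powRr1 ?ltW//; apply/implyP => _; rewrite gt_eqF.
have psn1 : psi - 1 != 0 by rewrite subr_eq0 lt_eqF.
have psn0 : psi != 0 by rewrite gt_eqF.
rewrite Ep; field. by rewrite psn0 psn1.
Qed.

(** At the price [marg (r * x + y) v] zero drift is optimal. At any other positive price zero drift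
    remains available with the same gain, so the maximal gain is no smaller. *)
Lemma Hmin_aggregator x y v : 0 < r * x + y -> v < 0 ->
  Hmin P x y v = (F (r * x + y) v)%:E.
Proof.
move=> c0 v0; apply/eqP; rewrite eq_le; apply/andP; split.
  apply: ereal_inf_lbound; exists (marg (r * x + y) v) => //.
  have m0 := marg_gt0 c0 v0.
  rewrite Ham_pos//; congr (_%:E).
  have -> : consumption v (marg (r * x + y) v) = r * x + y.
    apply/eqP; rewrite eq_le consumption_le// lexx /=.
    by rewrite -(marg_le v0)// ?consumption_gt0// marg_consumption.
  by rewrite /gain subrr mul0r add0r.
apply/le_ereal_inf_tmp => _ [p _ <-].
have [p0|p0|->] := ltgtP p 0.
- by rewrite /Ham p0 leey.
- rewrite Ham_pos// lee_fin.
  have := gain_tangent (r * x + y) v p c0 (consumption_gt0 p0 v0).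
  by rewrite marg_consumption// subrr mul0r addr0 {1}/gain subrr mul0r add0r.
(* At price 0 the power term vanishes, so [Ham] is 0, which exceeds the negative aggregator. *)
- rewrite /Ham ltxx powR0 ?subr_eq0 ?gt_eqF//.
  by rewrite !mulr0 mul0r addr0 lee_fin ltW// aggregator_lt0.
Qed.

Lemma Hup_gain x y v p : 0 < r * x + y -> v < 0 ->
  exists d, [/\ 0 < d, d <= r * x + y, Hup P x y v p = (gain (r * x + y) v p d)%:E
    & forall c, 0 < c -> c <= r * x + y ->
        gain (r * x + y) v p c <= gain (r * x + y) v p d].
Proof.
move=> c0 v0; have m0 := marg_gt0 c0 v0.
have [/= d0 dc0 dmax] := forward_argmax p c0 v0.
eexists; split; [exact: d0 | exact: dc0 | | exact: dmax].
rewrite /Hup -/(marg _ v); case: (leP (marg _ _) p) => mp.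
  have p0 := lt_le_trans m0 mp.
  by rewrite Ham_pos// cstar_pos// min_l// lee_fin consumption_le.
have Em : Order.min (cstar P v p) (r * x + y)%:E = (r * x + y)%:E.
  have [p0|p0] := leP p 0; first by rewrite cstar_npos// min_r// leey.
  by rewrite cstar_pos// min_r// lee_fin ltW// ltNge consumption_le// -ltNge.
by rewrite Hmin_aggregator// Em /= /gain subrr mul0r add0r.
Qed.

Lemma Hdown_ge x y v p c : 0 < r * x + y -> v < 0 -> r * x + y <= c ->
  ((gain (r * x + y) v p c)%:E <= Hdown P x y v p)%E.
Proof.
move=> c0 v0 c0c; have cp := lt_le_trans c0 c0c.
rewrite /Hdown -/(marg _ v); have [p0|p0|->] := ltgtP p 0; first by rewrite leey.
  case: (leP p) => pm.
    rewrite Ham_pos// lee_fin.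
    have := gain_tangent (r * x + y) v p cp (consumption_gt0 p0 v0).
    by rewrite marg_consumption// subrr mul0r addr0.
  rewrite Hmin_aggregator// lee_fin.
  apply: (le_trans (gain_tangent _ _ _ cp c0)).
  rewrite {1}/gain subrr mul0r add0r gerDl mulr_le0_ge0 ?subr_ge0 ?subr_le0//.
  exact: ltW.
rewrite (ltW (marg_gt0 c0 v0)) /Ham ltxx powR0 ?subr_eq0 ?gt_eqF// !mulr0 mul0r addr0.
by rewrite lee_fin /gain mulr0 add0r ltW// aggregator_lt0.
Qed.

(** A bound on the gains replaces a maximizer, since none need exist: for p < 0 the gains are
    unbounded, and at p = 0 they only approach 0. *)
Lemma Hdown_le x y v p M : 0 < r * x + y -> v < 0 ->
  (forall c, r * x + y <= c -> gain (r * x + y) v p c <= M) ->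
  (Hdown P x y v p <= M%:E)%E.
Proof.
move=> c0 v0 hM.
rewrite /Hdown -/(marg _ v); have [p0|p0|p0] := ltgtP p 0.
(* This c makes the drift term equal to [|M - F (r * x + y) v| + 1], which lifts the gain above
   M. *)
- exfalso; set c := r * x + y + (`|M - F (r * x + y) v| + 1) / (- p).
  have Np : 0 < - p by rewrite oppr_gt0.
  have c0c : r * x + y <= c by rewrite lerDl divr_ge0 ?ltW// ltr_wpDl.
  have := hM c c0c; rewrite /gain.
  have -> : (r * x + y - c) * p = `|M - F (r * x + y) v| + 1.
    by rewrite /c; field; rewrite lt_eqF.
  have := aggregator_homo_c v c0 c0c; have := ler_norm (M - F (r * x + y) v); lra.
- case: (leP p) => pm.
    rewrite Ham_pos// lee_fin; apply: hM.
    by rewrite -(marg_le v0)// ?consumption_gt0// marg_consumption.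
  rewrite Hmin_aggregator// lee_fin.
  by apply: le_trans (hM _ (lexx _)); rewrite /gain subrr mul0r add0r.
- rewrite p0 in hM *; rewrite (ltW (marg_gt0 c0 v0)) /Ham ltxx powR0 ?subr_eq0 ?gt_eqF// !mulr0 mul0r addr0.
  rewrite lee_fin; apply/ler_addgt0Pr => eta eta0.
  have [c [cp hc]] := aggregator_cvg0 v0 eta0.
  have := hM (Num.max c (r * x + y)); rewrite le_max lexx orbT => /(_ isT).
  have := hc (Num.max c (r * x + y)); rewrite le_max lexx => /(_ isT).
  by rewrite /gain mulr0 add0r; lra.
Qed.

End Prices.

(** * Controls on the grid *)

Section Grid.
Variables (R : realType) (P : params R) (n : nat).
Hypothesis hP : standing P.
Hypothesis hn : (0 < n)%N.
Implicit Types (v p c e M : R) (V W : 'M[R]_(n.+1, 2)) (i : 'I_n.+1) (j : 'I_2).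

Local Notation r := (rate P).
Local Notation F := (aggregator P).
Local Notation c0 i j := (cbar P j (xgrid P i)).

Lemma dx_gt0 : 0 < dx P n.
Proof.
rewrite divr_gt0 ?ltr0n// subr_gt0.
exact: le_lt_trans (xmin_le0 hP) (xmax_gt0 hP).
Qed.

Lemma xgrid_ge i : xmin P <= xgrid P i.
Proof. by rewrite lerDl mulr_ge0// ltW// dx_gt0. Qed.

Lemma xgrid_le i : xgrid P i <= xmax P.
Proof.
have -> : xmax P = xmin P + n%:R * dx P n.
  by rewrite /dx mulrC divfK ?pnatr_eq0 -?lt0n//; ring.
by rewrite lerD2l ler_wpM2r ?(ltW dx_gt0)// ler_nat -ltnS.
Qed.

Lemma income_bounds j : income P ord0 <= income P j <= income P ord_max.
Proof.
have y12 := ltW (income1_lt2 hP).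
case: j => -[|[|//]] hj.
  by have -> : Ordinal hj = ord0 by [exact: val_inj]; rewrite lexx.
by have -> : Ordinal hj = ord_max by [exact: val_inj]; rewrite lexx andbT.
Qed.

(** The borrowing bound involves rho; since r < rho and xmin <= 0, replacing rho by r only increases
    the product with xmin. *)
Lemma wealth_gt0 i : 0 < r * xgrid P i + income P ord0.
Proof.
have h1 := xmin_borrow hP; have h2 := xmin_le0 hP.
have h3 := rate_lt_rho hP; have h4 := rate_gt0 hP.
have : r * xmin P <= r * xgrid P i by rewrite ler_pM2l// xgrid_ge.
nra.
Qed.

Lemma cbar_gt0 i j : 0 < c0 i j.
Proof.
have := wealth_gt0 i; have /andP[] := income_bounds j.
by rewrite /cbar; lra.
Qed.

Lemma cbar_lt i j e : admissible P e -> c0 i j < 1 / e.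
Proof.
case=> _; apply: le_lt_trans; have /andP[_ ?] := income_bounds j.
by rewrite /cbar lerD// ler_pM2l ?xgrid_le// rate_gt0.
Qed.

(** The saving control is c1 and the dissaving control is c2. The boundary clauses forbid drift out
    of the grid, so out-of-range difference quotients get coefficient 0. *)
Definition control i j c1 c2 : Prop :=
  [/\ 0 < c1, c1 <= c0 i j, c0 i j <= c2,
      i = ord_max -> c1 = c0 i j & i = ord0 -> c2 = c0 i j].

(** Subtracting the zero-drift aggregator makes a control set to cbar contribute nothing. *)
Definition control_gain i j v pF pB c1 c2 : R :=
  gain P (c0 i j) v pF c1 + gain P (c0 i j) v pB c2 - F (c0 i j) v.

Lemma control_cbar i j : control i j (c0 i j) (c0 i j).
Proof. by split; rewrite ?cbar_gt0. Qed.

Lemma ord0_neq_max : (ord0 == ord_max :> 'I_n.+1) = false.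
Proof. by apply/eqP => /(congr1 val) /= h; move: hn; rewrite -h. Qed.

Lemma gain_cbar i j v p : gain P (c0 i j) v p (c0 i j) = F (c0 i j) v.
Proof. by rewrite /gain subrr mul0r add0r. Qed.

(** The forward and backward maximizations decouple, and admissibility places 1 / e above cbar. *)
Lemma Hreg_argmax e i j v pF pB : admissible P e -> v < 0 ->
  exists c1 c2, [/\ control i j c1 c2, c2 <= 1 / e,
    Hreg P e i j v pF pB = control_gain i j v pF pB c1 c2 &
    forall c1' c2', control i j c1' c2' -> c2' <= 1 / e ->
      control_gain i j v pF pB c1' c2' <= Hreg P e i j v pF pB].
Proof.
move=> he v0; have c0p := cbar_gt0 i j; have c0e := cbar_lt i j he.
exists (cF P i j v pF), (cB P e i j v pB).
have HE : Hreg P e i j v pF pB =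
    control_gain i j v pF pB (cF P i j v pF) (cB P e i j v pB).
  by rewrite /Hreg /control_gain /gain; ring.
have HF : [/\ 0 < cF P i j v pF, cF P i j v pF <= c0 i j,
    i = ord_max -> cF P i j v pF = c0 i j &
    forall c, 0 < c -> c <= c0 i j -> (i = ord_max -> c = c0 i j) ->
      gain P (c0 i j) v pF c <= gain P (c0 i j) v pF (cF P i j v pF)].
  rewrite /cF; case: eqP => [iM|niM].
    by split=> // c _ _ ->.
  by have [? ? h] := forward_argmax hP pF c0p v0; split=> // c ? ? _; exact: h.
have HB : [/\ c0 i j <= cB P e i j v pB, cB P e i j v pB <= 1 / e,
    i = ord0 -> cB P e i j v pB = c0 i j &
    forall c, c0 i j <= c -> c <= 1 / e -> (i = ord0 -> c = c0 i j) ->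
      gain P (c0 i j) v pB c <= gain P (c0 i j) v pB (cB P e i j v pB)].
  rewrite /cB; case: eqP => [i0|ni0].
    by split=> //; [exact: ltW | move=> c _ _ ->].
  by have [? ? h] := backward_argmax hP pB c0p c0e v0; split=> // c ? ? _; exact: h.
case: HF => F1 F2 F3 F4; case: HB => B1 B2 B3 B4.
split=> // c1 c2 [? ? ? ? ?] ?.
by rewrite HE /control_gain lerD2r lerD ?F4 ?B4.
Qed.

Lemma Hbold_ge i j v pF pB c1 c2 : v < 0 -> control i j c1 c2 ->
  ((control_gain i j v pF pB c1 c2)%:E <= Hbold P i j v pF pB)%E.
Proof.
move=> v0 [c1p c1c c2c hM h0]; have cp := cbar_gt0 i j.
have [d [dp dc HupE dmax]] := Hup_gain hP pF cp v0.
rewrite /Hbold /control_gain; case: eqP => [i0|_].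
  by rewrite h0// gain_cbar addrK HupE lee_fin dmax.
case: eqP => [iM|_].
  rewrite hM// gain_cbar addrAC subrr add0r; exact: Hdown_ge.
rewrite HupE Hmin_aggregator// EFinB EFinD leeD2r// leeD//.
  by rewrite lee_fin dmax.
exact: Hdown_ge.
Qed.

(** The forward supremum is attained at some d; with c1 = d fixed, only c2 varies and [Hdown_le]
    applies. *)
Lemma Hbold_le i j v pF pB M : v < 0 ->
  (forall c1 c2, control i j c1 c2 -> control_gain i j v pF pB c1 c2 <= M) ->
  (Hbold P i j v pF pB <= M%:E)%E.
Proof.
move=> v0 hM; have cp := cbar_gt0 i j.
have [d [dp dc HupE dmax]] := Hup_gain hP pF cp v0.
rewrite /Hbold; case: eqP => [i0|ni0].
  rewrite HupE lee_fin; have := hM d (c0 i j).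
  rewrite /control_gain gain_cbar addrK; apply; split=> //.
  by move=> iM; move: ord0_neq_max; rewrite -i0 iM eqxx.
case: eqP => [iM|niM].
  apply: Hdown_le => // c hc; have := hM (c0 i j) c.
  by rewrite /control_gain gain_cbar addrAC subrr add0r; apply; split.
have : (Hdown P (xgrid P i) (income P j) v pB <=
        (M - gain P (c0 i j) v pF d + F (c0 i j) v)%:E)%E.
  apply: Hdown_le => // c hc; have : control i j d c by split.
  by move=> /hM; rewrite /control_gain; lra.
move=> h; rewrite HupE Hmin_aggregator//.
apply: (@le_trans _ _ ((gain P (c0 i j) v pF d)%:E + 
  (M - gain P (c0 i j) v pF d + F (c0 i j) v)%:E - (F (c0 i j) v)%:E)%E).
  by rewrite leeD2r// leeD2l.
by rewrite lee_fin; lra.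
Qed.

End Grid.

(** * Least fixed points of monotone maps on an order interval *)

Section LeastFixedPoint.
Variables (R : realType) (n : nat).
Implicit Types U V W : 'M[R]_(n.+1, 2).

Lemma preceq_trans U V W : preceq U V -> preceq V W -> preceq U W.
Proof. by move=> h1 h2 i j; exact: le_trans (h1 i j) (h2 i j). Qed.

(** Knaster-Tarski: L is the entrywise infimum of the W with [preceq (T W) W]. Monotonicity puts L,
    and then T L, among them. Leastness over all these W later gives comparison with
    supersolutions. *)
Lemma least_fixed_point (T : 'M[R]_(n.+1, 2) -> 'M[R]_(n.+1, 2)) U V :
  preceq U V ->
  (forall W W', preceq U W -> preceq W W' -> preceq W' V ->
     preceq (T W) (T W')) ->
  preceq U (T U) -> preceq (T V) V ->
  exists L, [/\ preceq U L, preceq L V, T L = L &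
    forall W, preceq U W -> preceq W V -> preceq (T W) W -> preceq L W].
Proof.
move=> UV Tmono UTU TVV.
have refl W : @preceq R n W W by move=> i j.
pose S := [set W | [/\ preceq U W, preceq W V & preceq (T W) W]].
pose L : 'M[R]_(n.+1, 2) := \matrix_(i, j) inf [set W i j | W in S].
have SV : S V by split.
have lbS i j : lbound [set W i j | W in S] (U i j).
  by move=> _ [W [UW _ _] <-]; exact: UW.
have LS W : S W -> preceq L W.
  move=> SW i j; rewrite mxE; apply: ge_inf; last by exists W.
  by exists (U i j); exact: lbS.
have geL X : (forall W, S W -> preceq X W) -> preceq X L.
  move=> h i j; rewrite mxE; apply: lb_le_inf; first by exists (V i j), V.
  by move=> _ [W SW <-]; exact: h.
have UL : preceq U L by apply: geL => W [].
have LV : preceq L V by exact: LS.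
have TLL : preceq (T L) L.
  apply: geL => W SW; have [UW WV TWW] := SW.
  by apply: preceq_trans TWW; apply: Tmono => //; exact: LS.
have UTL : preceq U (T L) by apply: preceq_trans UTU _; exact: Tmono.
have LTL : preceq L (T L).
  apply: LS; split => //; first exact: preceq_trans TLL LV.
  exact: Tmono.
exists L; split => //; last by move=> W ? ? ?; exact: LS.
by apply/matrixP => i j; apply/eqP; rewrite eq_le TLL LTL.
Qed.

End LeastFixedPoint.

(** * Barriers *)

Section Barriers.
Variables (R : realType) (P : params R) (n : nat).
Hypothesis hP : standing P.
Hypothesis hn : (0 < n)%N.
Hypothesis htheta : 0 < theta P /\ theta P < 1.
Implicit Types (v p c e M : R) (V W : 'M[R]_(n.+1, 2)) (i : 'I_n.+1) (j : 'I_2).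

Local Notation gamma := (gamma P).
Local Notation psi := (psi P).
Local Notation rho := (rho P).
Local Notation r := (rate P).
Local Notation theta := (theta P).
Local Notation F := (aggregator P).
Local Notation c0 i j := (cbar P j (xgrid P i)).
Local Notation dx := (dx P n).
Local Notation gain_at V i j :=
  (control_gain P i j (V i j) (Dplus P V i j) (Dminus P V i j)).
Local Notation Hreg_at e V i j :=
  (Hreg P e i j (V i j) (Dplus P V i j) (Dminus P V i j)).

Let gamma1 : 1 < gamma := gamma_gt1 hP.
Let psi0 : 0 < psi := psi_gt0 hP.
Let psi1 : psi < 1 := psi_lt1 hP.

Definition residual V i j : R :=
  rho / theta * V i j - lambda P j * (V i (rev_ord j) - V i j).

Definition supersolution e V : Prop := forall i j, Hreg_at e V i j <= residual V i j.

Lemma crra_le a a' : 0 < a -> a <= a' ->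
  a `^ (1 - gamma) / (1 - gamma) <= a' `^ (1 - gamma) / (1 - gamma).
Proof.
move=> a0 aa'; have a'0 := lt_le_trans a0 aa'.
have g0 : 1 - gamma < 0 by rewrite subr_lt0.
apply: (le_trans (powR_tangent a0 a'0 g0)).
by rewrite gerDl mulr_ge0_le0 ?powR_ge0// subr_le0.
Qed.

Lemma crra_scaled a : (1 - gamma) * (a `^ (1 - gamma) / (1 - gamma)) = a `^ (1 - gamma).
Proof. by rewrite mulrC divfK// subr_eq0 lt_eqF. Qed.

Lemma crra_lt0 a : 0 < a -> a `^ (1 - gamma) / (1 - gamma) < 0.
Proof. by move=> a0; rewrite pmulr_rlt0 ?powR_gt0// invr_lt0 subr_lt0. Qed.

(** By [theta_mul] the exponents of a add up to [- gamma]. *)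
Lemma marg_crra k a : 0 < k -> 0 < a ->
  marg P (k * a) (a `^ (1 - gamma) / (1 - gamma)) =
  rho * k `^ (- psi^-1) * a `^ (- gamma).
Proof.
move=> k0 a0; rewrite /marg crra_scaled powRM ?ltW// -powRrM -!mulrA -powRD.
  congr (_ * (_ * _ `^ _)).
  have := theta_mul hP; lra.
by apply/implyP => _; rewrite gt_eqF.
Qed.

(** The utility of consuming a forever is stationary; this is Euler's identity combined with
    [marg_crra] at k = 1. *)
Lemma aggregator_crra a : 0 < a ->
  F a (a `^ (1 - gamma) / (1 - gamma)) =
  rho / theta * (a `^ (1 - gamma) / (1 - gamma)).
Proof.
move=> a0; rewrite aggregator_marg// -[X in marg P X]mul1r marg_crra//.
have g0 : 1 - gamma != 0 by rewrite subr_eq0 lt_eqF.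
have t0 : theta != 0 by rewrite gt_eqF//; case: htheta.
have -> : a `^ (1 - gamma) = a * a `^ (- gamma).
  by rewrite powRD ?powRr1 ?ltW//; apply/implyP => _; rewrite gt_eqF.
rewrite powR1 -(theta_mul hP); field; by rewrite g0 t0.
Qed.

Lemma residual_rev V i j : V i (rev_ord j) = V i j ->
  residual V i j = rho / theta * V i j.
Proof. by move=> E; rewrite /residual E subrr mulr0 subr0. Qed.

(** The zero-drift control suffices: it consumes at least [r * x + y_1], whose perpetual utility is
    the lower barrier. *)
Lemma Ulow_sub e i j : admissible P e ->
  residual (Ulow P n) i j <= Hreg_at e (Ulow P n) i j.
Proof.
move=> he; have a0 := wealth_gt0 hP hn i; have c0p := cbar_gt0 hP hn i j.
have [_ [_ [_ _ _ hmax]]] := Hreg_argmax hP hn i j (Dplus P (Ulow P n) i j)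
  (Dminus P (Ulow P n) i j) he (crra_lt0 a0).
rewrite residual_rev ?mxE//.
apply: le_trans (hmax _ _ (control_cbar hP hn i j) (ltW (cbar_lt hP hn i j he))).
rewrite /control_gain !gain_cbar addrK -aggregator_crra//.
apply: aggregator_homo_c => //.
by rewrite lerD2l; have /andP[] := income_bounds hP j.
Qed.

Local Notation beta := (r + psi * (rho - r)).

Lemma beta_gt0 : 0 < beta.
Proof.
by rewrite addr_gt0 ?(rate_gt0 hP)// mulr_gt0// subr_gt0 (rate_lt_rho hP).
Qed.

Lemma bcoef_gt0 : 0 < bcoef P.
Proof.
by rewrite mulr_gt0 ?(rho_gt0 hP)// powR_gt0// divr_gt0 ?beta_gt0 ?(rho_gt0 hP).
Qed.

(** After dividing by rho and raising to the power 1 - psi, this is the weighted mean inequality for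
    1 and r / rho, with mean [beta / rho]. *)
Lemma bcoef_ge_rate : r <= bcoef P.
Proof.
have rho0 := rho_gt0 hP; have r0 := rate_gt0 hP.
rewrite /bcoef mulrC -ler_pdivrMr//.
have s0 : 0 < r / rho by rewrite divr_gt0.
have -> : r / rho = ((r / rho) `^ (1 - psi)) `^ (1 / (1 - psi)).
  rewrite -powRrM div1r divff ?powRr1 ?ltW// subr_eq0 gt_eqF//.
apply: ge0_ler_powR; rewrite ?nnegrE ?powR_ge0//.
- by rewrite div1r invr_ge0 subr_ge0 ltW.
- by rewrite divr_ge0// ltW// beta_gt0.
have := @powR_le_linear R (r / rho) (1 - psi) s0.
have -> : 1 - (1 - psi) + (1 - psi) * (r / rho) = beta / rho.
  by field; rewrite gt_eqF.
by apply; rewrite subr_ge0 gerBl !ltW.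
Qed.

(** First-order condition of the frictionless problem: [beta] is the propensity to consume out of
    total wealth. *)
Lemma bcoef_foc : rho * (beta / bcoef P) `^ (- psi^-1) = bcoef P.
Proof.
have rho0 := rho_gt0 hP; have b0 := beta_gt0.
have psn0 : psi != 0 by rewrite gt_eqF.
have psn1 : 1 - psi != 0 by rewrite subr_eq0 gt_eqF.
rewrite {2}/bcoef; congr (_ * _).
set t := beta / rho; have t0 : 0 < t by rewrite divr_gt0.
have -> : beta / bcoef P = t `^ (1 - 1 / (1 - psi)).
  rewrite powRB; last by apply/implyP => _; rewrite gt_eqF.
  rewrite powRr1 ?ltW// /bcoef -/t /t; field.
  by rewrite !gt_eqF// powR_gt0.
by rewrite -powRrM; congr (_ `^ _); field; rewrite psn0 psn1.
Qed.

Lemma rate_human_wealth (x y : R) : r * (x + y / r) = r * x + y.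
Proof. by field; rewrite gt_eqF// (rate_gt0 hP). Qed.

Lemma human_wealth_gt0 i : 0 < xgrid P i + income P ord_max / r.
Proof.
have r0 := rate_gt0 hP.
rewrite -(pmulr_rgt0 _ r0) rate_human_wealth.
by have := wealth_gt0 hP hn i; have := income1_lt2 hP; lra.
Qed.

Lemma Ulow_le_Vhigh : preceq (Ulow P n) (Vhigh P n).
Proof.
move=> i j; rewrite !mxE; apply: crra_le; first exact: wealth_gt0.
have r0 := rate_gt0 hP.
apply: (@le_trans _ _ (r * (xgrid P i + income P ord_max / r))).
  rewrite rate_human_wealth lerD2l.
  exact/ltW/(income1_lt2 hP).
by rewrite ler_wpM2r ?bcoef_ge_rate// ltW// human_wealth_gt0.
Qed.

Lemma Vhigh_lt0 i j : Vhigh P n i j < 0.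
Proof. by rewrite mxE crra_lt0// mulr_gt0 ?bcoef_gt0 ?human_wealth_gt0. Qed.

(* The tangent of the concave F(., v) at c0 shows that at a single price p
   either the forward or the backward control is redundant. *)
Lemma control_gain_le_gain i j v pF pB p c1 c2 : 
  control P i j c1 c2 ->
  (i <> ord_max -> pF <= p) -> (i <> ord0 -> p <= pB) ->
  control_gain P i j v pF pB c1 c2 <=
  Num.max (gain P (c0 i j) v p c1) (gain P (c0 i j) v p c2).
Proof.
move=> [c1p c1c c2c hM h0] hF hB; have cp := cbar_gt0 hP hn i j.
have E1 : gain P (c0 i j) v pF c1 <= gain P (c0 i j) v p c1.
  rewrite /gain lerD2r; case: (eqVneq i ord_max) => [/hM ->|/eqP/hF ?].
    by rewrite subrr !mul0r.
  by rewrite ler_wpM2l// subr_ge0.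
have E2 : gain P (c0 i j) v pB c2 <= gain P (c0 i j) v p c2.
  rewrite /gain lerD2r; case: (eqVneq i ord0) => [/h0 ->|/eqP/hB ?].
    by rewrite subrr !mul0r.
  by rewrite ler_wnM2l// subr_le0.
have c2p := lt_le_trans cp c2c.
have G1 := gain_tangent hP (c0 i j) v p c1p cp.
have G2 := gain_tangent hP (c0 i j) v p c2p cp.
rewrite gain_cbar in G1 G2; rewrite /control_gain le_max; apply/orP.
case: (leP (marg P (c0 i j) v) p) => mp; [left|right].
  have : (marg P (c0 i j) v - p) * (c2 - c0 i j) <= 0.
    by rewrite mulr_le0_ge0 ?subr_ge0 ?subr_le0.
  lra.
have : (marg P (c0 i j) v - p) * (c1 - c0 i j) <= 0.
  by rewrite mulr_ge0_le0 ?subr_ge0 ?subr_le0// ltW.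
lra.
Qed.

Lemma crra_wealth_slope (z z' : R) : 0 < z -> 0 < z' ->
  (bcoef P * z') `^ (1 - gamma) / (1 - gamma) <=
  (bcoef P * z) `^ (1 - gamma) / (1 - gamma) +
    bcoef P * (bcoef P * z) `^ (- gamma) * (z' - z).
Proof.
move=> z0 z'0; have b0 := bcoef_gt0.
have g0 : 1 - gamma < 0 by rewrite subr_lt0.
have := powR_tangent (mulr_gt0 b0 z'0) (mulr_gt0 b0 z0) g0.
have -> : 1 - gamma - 1 = - gamma by ring.
by rewrite -mulrBr mulrA [_ * bcoef P]mulrC.
Qed.

(** The price is the derivative of the frictionless value in total wealth z. By [bcoef_foc] the gain
    is stationary at [beta * z], where equality holds. *)
Lemma gain_Vhigh c z : 0 < c -> 0 < z ->
  gain P (r * z) ((bcoef P * z) `^ (1 - gamma) / (1 - gamma))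
    (bcoef P * (bcoef P * z) `^ (- gamma)) c <=
  rho / theta * ((bcoef P * z) `^ (1 - gamma) / (1 - gamma)).
Proof.
move=> cp z0; have b0 := bcoef_gt0; have be0 := beta_gt0.
have bz0 := mulr_gt0 b0 z0.
set p := bcoef P * (bcoef P * z) `^ (- gamma).
set v := _ / (1 - gamma).
have d0 : 0 < beta * z by rewrite mulr_gt0.
have Em : marg P (beta * z) v = p.
  have -> : beta * z = beta / bcoef P * (bcoef P * z).
    by rewrite mulrA divfK// gt_eqF.
  by rewrite marg_crra ?divr_gt0// bcoef_foc.
apply: (le_trans (gain_tangent hP (r * z) v p cp d0)).
rewrite Em subrr mul0r addr0 /gain aggregator_marg// Em.
have g0 : 1 - gamma != 0 by rewrite subr_eq0 lt_eqF.
have t0 : theta != 0 by rewrite gt_eqF//; case: htheta.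
have psn0 : psi != 0 by rewrite gt_eqF.
have psn1 : psi - 1 != 0 by rewrite subr_eq0 lt_eqF.
have Ev : v = p * z / (1 - gamma).
  have -> : p * z = bcoef P * z * (bcoef P * z) `^ (- gamma) by rewrite /p; ring.
  rewrite /v powRD ?powRr1 ?ltW//; apply/implyP => _; by rewrite gt_eqF.
have -> : rho / theta * v = rho * p * z / (theta * (1 - gamma)).
  by rewrite Ev; field; rewrite g0 t0.
rewrite (theta_mul hP) le_eqVlt; apply/orP; left; apply/eqP; field.
by rewrite psn0 psn1.
Qed.

Lemma xgridB i (k : 'I_n.+1) : xgrid P k - xgrid P i = (k%:R - i%:R) * dx.
Proof. by rewrite /xgrid; ring. Qed.

(** The upper barrier is concave in wealth, so forward quotients lie below its derivative;
    [Dminus_Vhigh_ge] is the mirror image. *)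
Lemma Dplus_Vhigh_le i j : i <> ord_max ->
  Dplus P (Vhigh P n) i j <=
  bcoef P * (bcoef P * (xgrid P i + income P ord_max / r)) `^ (- gamma).
Proof.
move=> iM; rewrite /Dplus ler_pdivrMr ?(dx_gt0 hP)// lerBlDl !mxE.
apply: le_trans (crra_wealth_slope (human_wealth_gt0 i) (human_wealth_gt0 _)) _.
rewrite lerD2l.
have -> : xgrid P (inord i.+1 : 'I_n.+1) + income P ord_max / r
    - (xgrid P i + income P ord_max / r)
    = xgrid P (inord i.+1 : 'I_n.+1) - xgrid P i by ring.
rewrite xgridB inordK; first by rewrite -natrB ?subSnn ?mul1r.
rewrite ltnS ltn_neqAle -ltnS ltn_ord andbT.
by apply/eqP => h; apply: iM; exact: val_inj.
Qed.

Lemma Dminus_Vhigh_ge i j : i <> ord0 ->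
  bcoef P * (bcoef P * (xgrid P i + income P ord_max / r)) `^ (- gamma) <=
  Dminus P (Vhigh P n) i j.
Proof.
move=> i0; rewrite /Dminus ler_pdivlMr ?(dx_gt0 hP)// !mxE.
have i_gt0 : (0 < i)%N.
  by rewrite lt0n; apply/eqP => h; apply: i0; exact: val_inj.
have := crra_wealth_slope (human_wealth_gt0 i) (human_wealth_gt0 (inord i.-1)).
have -> : xgrid P (inord i.-1 : 'I_n.+1) + income P ord_max / r
    - (xgrid P i + income P ord_max / r) = - dx.
  transitivity (xgrid P (inord i.-1 : 'I_n.+1) - xgrid P i); first ring.
  rewrite xgridB inordK; last by rewrite (leq_ltn_trans (leq_pred _)).
  rewrite -{2}(prednK i_gt0) -natr1; ring.
by rewrite mulrN; lra.
Qed.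

(** The derivative of the barrier serves as the single price. It is nonnegative, so raising income
    to y_2 only raises the gain, and [gain_Vhigh] applies. *)
Lemma Vhigh_super i j c1 c2 : control P i j c1 c2 ->
  gain_at (Vhigh P n) i j c1 c2 <= residual (Vhigh P n) i j.
Proof.
move=> hc; have [c1p _ c2c _ _] := hc; have z0 := human_wealth_gt0 i.
have c2p := lt_le_trans (cbar_gt0 hP hn i j) c2c.
have r0 := rate_gt0 hP.
apply: (le_trans (control_gain_le_gain _ hc (@Dplus_Vhigh_le i j) (@Dminus_Vhigh_ge i j))).
rewrite residual_rev ?mxE//.
set p := bcoef P * _ `^ _; set v := _ / (1 - gamma).
have p0 : 0 <= p by rewrite mulr_ge0 ?powR_ge0 ?ltW ?bcoef_gt0.
have H c : 0 < c -> gain P (c0 i j) v p c <= rho / theta * v.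
  move=> cp; apply: le_trans (gain_Vhigh cp z0).
  rewrite /gain lerD2r ler_wpM2r// lerD2r rate_human_wealth.
  by rewrite /cbar lerD2l; have /andP[] := income_bounds hP j.
by rewrite ge_max !H.
Qed.

End Barriers.

(** * Minimal solutions of the regularized system *)

Section MinimalSolutions.
Variables (R : realType) (P : params R) (n : nat).
Hypothesis hP : standing P.
Hypothesis hn : (0 < n)%N.
Hypothesis htheta : 0 < theta P /\ theta P < 1.
Implicit Types (v p c e M : R) (V W : 'M[R]_(n.+1, 2)) (i : 'I_n.+1) (j : 'I_2).

Local Notation rho := (rho P).
Local Notation theta := (theta P).
Local Notation F := (aggregator P).
Local Notation c0 i j := (cbar P j (xgrid P i)).
Local Notation dx := (dx P n).
Local Notation gain_at V i j :=
  (control_gain P i j (V i j) (Dplus P V i j) (Dminus P V i j)).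
Local Notation Hreg_at e V i j :=
  (Hreg P e i j (V i j) (Dplus P V i j) (Dminus P V i j)).

Lemma below_Vhigh_lt0 V i j : preceq V (Vhigh P n) -> V i j < 0.
Proof. by move=> h; exact: le_lt_trans (h i j) (Vhigh_lt0 hP hn i j). Qed.

Lemma systemRE e V : systemR P e V <-> forall i j, Hreg_at e V i j = residual P V i j.
Proof.
split=> h i j; have := h i j; rewrite /residual; first by move=> ->; ring.
by move=> ->; ring.
Qed.

Lemma systemDE V : systemD P V <-> forall i j,
  Hbold P i j (V i j) (Dplus P V i j) (Dminus P V i j) = (residual P V i j)%:E.
Proof.
split=> h i j; have := h i j; rewrite /residual.
  case: Hbold => [a| |] //= []; rewrite /= => E; congr (_%:E).
  by rewrite E; ring.
by move=> ->; rewrite -EFinD; congr (_%:E); ring.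
Qed.

(** Neighbouring values enter with nonnegative coefficients, the added term cancels the diagonal
    coefficient, and the aggregator terms increase in v. *)
Lemma control_gain_mono V W i j c1 c2 : control P i j c1 c2 ->
  preceq V W -> W i j < 0 ->
  gain_at V i j c1 c2 + (c2 - c1) / dx * V i j <=
  gain_at W i j c1 c2 + (c2 - c1) / dx * W i j.
Proof.
move=> [c1p c1c c2c _ _] VW w0; have dx0 := dx_gt0 hP hn.
have c2p := lt_le_trans (cbar_gt0 hP hn i j) c2c.
have G1 := aggregator_diff_homo_v hP htheta c1p c1c (VW i j) w0.
have G2 := aggregator_homo_v hP htheta c2p (VW i j) w0.
have H1 : 0 <= (c0 i j - c1) / dx * (W (inord i.+1) j - V (inord i.+1) j).
  by apply: mulr_ge0; [rewrite divr_ge0 ?(ltW dx0) ?subr_ge0 | rewrite subr_ge0; exact: VW].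
have H2 : 0 <= (c2 - c0 i j) / dx * (W (inord i.-1) j - V (inord i.-1) j).
  by apply: mulr_ge0; [rewrite divr_ge0 ?(ltW dx0) ?subr_ge0 | rewrite subr_ge0; exact: VW].
rewrite -subr_ge0 /control_gain /gain /Dplus /Dminus.
set a1 := W (inord i.+1) j in H1 *; set a2 := V (inord i.+1) j in H1 *.
set b1 := W (inord i.-1) j in H2 *; set b2 := V (inord i.-1) j in H2 *.
have := addr_ge0 H1 H2; lra.
Qed.

Lemma Hreg_mono e V W i j : admissible P e -> preceq V W -> W i j < 0 ->
  Hreg_at e V i j + (1 / e) / dx * V i j <= Hreg_at e W i j + (1 / e) / dx * W i j.
Proof.
move=> he VW w0; have v0 := le_lt_trans (VW i j) w0; have dx0 := dx_gt0 hP hn.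
have [c1 [c2 [hc c2e -> _]]] := Hreg_argmax hP hn i j (Dplus P V i j) (Dminus P V i j) he v0.
have [_ [_ [_ _ _ hmax]]] := Hreg_argmax hP hn i j (Dplus P W i j) (Dminus P W i j) he w0.
have h1 := hmax _ _ hc c2e.
have h2 := control_gain_mono hc VW w0.
have [c1p _ _ _ _] := hc.
have h3 : 0 <= (1 / e - (c2 - c1)) / dx * (W i j - V i j).
  apply: mulr_ge0; last by rewrite subr_ge0; exact: VW.
  by rewrite divr_ge0 ?(ltW dx0)//; lra.
lra.
Qed.

Lemma Hreg_mono_neighbours e V W i j : admissible P e -> preceq V W ->
  W i j < 0 -> V i j = W i j -> Hreg_at e V i j <= Hreg_at e W i j.
Proof. by move=> he VW w0 E; have := Hreg_mono he VW w0; rewrite E lerD2r. Qed.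

Lemma minimal_solutionR_exists e : admissible P e ->
  exists V, minimal_solution P (systemR P e) V /\
    forall W, preceq (Ulow P n) W -> preceq W (Vhigh P n) ->
      supersolution P e W -> preceq V W.
Proof.
move=> he; have dx0 := dx_gt0 hP hn; have [e0 _] := he.
have [theta0 _] := htheta.
(* [K] dominates every diagonal coefficient: (c2 - c1) / dx <= (1 / e) / dx from the drift, the rest
   from [residual]. *)
pose K j := (1 / e) / dx + lambda P j + rho / theta.
have K0 j : 0 < K j.
  have h1 : 0 < 1 / e / dx by rewrite !mulr_gt0 ?invr_gt0.
  have h2 : 0 < rho / theta by rewrite divr_gt0// (rho_gt0 hP).
  by have := lambda_gt0 hP j; rewrite /K; lra.
(* Fixed points of [T] are the solutions, and supersolutions are mapped below themselves. *)
pose T V : 'M[R]_(n.+1, 2) :=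
  \matrix_(i, j) (V i j + (K j)^-1 * (Hreg_at e V i j - residual P V i j)).
have TK : forall V i j, K j * T V i j = K j * V i j + (Hreg_at e V i j - residual P V i j).
  by move=> V i j; rewrite mxE mulrDr mulrA divff ?gt_eqF// mul1r.
have Tsuper V : supersolution P e V -> preceq (T V) V.
  move=> h i j; rewrite -(ler_pM2l (K0 j)) TK gerDl subr_le0; exact: h.
have Usub : preceq (Ulow P n) (T (Ulow P n)).
  move=> i j; rewrite -(ler_pM2l (K0 j)) TK lerDl subr_ge0.
  exact: Ulow_sub.
have Vsuper : supersolution P e (Vhigh P n).
  move=> i j; have [c1 [c2 [hc _ -> _]]] := Hreg_argmax hP hn i j
    (Dplus P (Vhigh P n) i j) (Dminus P (Vhigh P n) i j) he (Vhigh_lt0 hP hn i j).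
  exact: Vhigh_super.
have Tmono V W : preceq (Ulow P n) V -> preceq V W -> preceq W (Vhigh P n) ->
    preceq (T V) (T W).
  move=> _ VW WVh i j; rewrite -(ler_pM2l (K0 j)) !TK /residual /K.
  have := Hreg_mono he VW (below_Vhigh_lt0 i j WVh).
  have := ler_wpM2l (ltW (lambda_gt0 hP j)) (VW i (rev_ord j)); lra.
have [L [UL LV TL Lmin]] :=
  least_fixed_point (Ulow_le_Vhigh hP hn) Tmono Usub (Tsuper _ Vsuper).
have LR : systemR P e L.
  apply/systemRE => i j; have := TK L i j; rewrite TL; lra.
exists L; split; last by move=> W UW WV /Tsuper; exact: Lmin.
split=> // W [WR UW WV]; apply: Lmin => //; apply: Tsuper => i j.
by move/systemRE : WR => ->.
Qed.

Lemma minimal_solutionR_le e V W : admissible P e ->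
  minimal_solution P (systemR P e) V ->
  preceq (Ulow P n) W -> preceq W (Vhigh P n) -> supersolution P e W ->
  preceq V W.
Proof.
move=> he [_ Vmin] UW WV Wsuper.
have [L [[Lsol _] Lmin]] := minimal_solutionR_exists he.
exact: preceq_trans (Vmin _ Lsol) (Lmin _ UW WV Wsuper).
Qed.

Lemma admissible_lt e e' : admissible P e -> 0 < e' -> e' < e -> admissible P e'.
Proof.
case=> e0 he e'0 e'e; split=> //; apply: lt_trans he _.
by rewrite !div1r ltf_pV2 ?posrE.
Qed.

(** The control optimal for e stays available for e', so W is a supersolution for e. *)
Lemma minimal_solutionR_anti e e' V W : admissible P e -> 0 < e' -> e' < e ->
  minimal_solution P (systemR P e) V -> minimal_solution P (systemR P e') W ->
  preceq V W.
Proof.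
move=> he e'0 e'e hV [[WR UW WV] _].
have [e0 _] := he; have he' := admissible_lt he e'0 e'e.
apply: (minimal_solutionR_le he hV) => // i j; move/systemRE : WR => <-.
have w0 := below_Vhigh_lt0 i j WV.
have [c1 [c2 [hc c2e -> _]]] :=
  Hreg_argmax hP hn i j (Dplus P W i j) (Dminus P W i j) he w0.
have [_ [_ [_ _ _ hmax]]] :=
  Hreg_argmax hP hn i j (Dplus P W i j) (Dminus P W i j) he' w0.
apply: hmax => //; apply: le_trans c2e _.
by rewrite !div1r lef_pV2 ?posrE// ltW.
Qed.

Lemma Ulow_homo i (k : 'I_n.+1) j : (i <= k)%N -> Ulow P n i j <= Ulow P n k j.
Proof.
move=> ik; rewrite !mxE; apply: crra_le => //; first exact: wealth_gt0.
rewrite lerD2r ler_pM2l ?(rate_gt0 hP)// -subr_ge0 xgridB.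
by rewrite mulr_ge0 ?(ltW (dx_gt0 hP hn))// subr_ge0 ler_nat.
Qed.

(* Forcing monotonicity in wealth from above, W i = min over k >= i of V k,
   yields a supersolution again. *)
Lemma minimal_solutionR_homo e V i (k : 'I_n.+1) j : admissible P e ->
  minimal_solution P (systemR P e) V -> (i <= k)%N -> V i j <= V k j.
Proof.
move=> he hV ik; have [[/systemRE VR UV VVh] _] := hV.
have dx0 := dx_gt0 hP hn.
pose m i j := Order.arg_min i (fun k : 'I_n.+1 => (i <= k)%N) (fun k => V k j).
have mP i' j' : (i' <= m i' j')%N /\ forall k : 'I_n.+1, (i' <= k)%N -> V (m i' j') j' <= V k j'.
  by rewrite /m; case: arg_minP => // k' ? h; split.
pose W : 'M[R]_(n.+1, 2) := \matrix_(i, j) V (m i j) j.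
have WE i' j' : W i' j' = V (m i' j') j' by rewrite mxE.
have Wle i' j' (k' : 'I_n.+1) : (i' <= k')%N -> W i' j' <= V k' j'.
  by rewrite WE; exact: (mP i' j').2.
have Whomo i1 i2 j' : (i1 <= i2)%N -> W i1 j' <= W i2 j'.
  move=> h; rewrite (WE i2); apply: Wle.
  exact: leq_trans h (mP _ _).1.
have WV : preceq W V by move=> i' j'; exact: Wle.
have UW : preceq (Ulow P n) W.
  move=> i' j'; rewrite WE; apply: le_trans (UV _ _).
  exact: Ulow_homo (mP _ _).1.
have WVh := preceq_trans WV VVh.
suff /(_ i j) VW : preceq V W by apply: le_trans VW (Wle _ _ _ ik).
apply: (minimal_solutionR_le he hV) => // {i k ik j} i j.
have w0 := below_Vhigh_lt0 i j WVh.
have [ik kmin] := mP i j; rewrite -/(m i j) in ik kmin.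
set k := m i j in ik kmin.
have WVk : W i j = V k j by rewrite WE.
have resW : residual P V k j <= residual P W i j.
  rewrite /residual WVk lerD2l lerN2 ler_pM2l ?(lambda_gt0 hP)// lerD2r.
  exact: Wle.
apply: le_trans resW; rewrite -VR.
(* If the minimum sits at i itself, W and V agree there and W is below V at the neighbours. *)
have [Eki|nki] := eqVneq k i.
  rewrite Eki; apply: Hreg_mono_neighbours => //; last by rewrite WVk Eki.
  exact: below_Vhigh_lt0.
have {}ik : (i < k)%N by rewrite ltn_neqAle eq_sym nki.
have in1 : (i.+1 < n.+1)%N by exact: leq_ltn_trans ik (ltn_ord k).
(* The minimum is reached strictly above i, so W is flat from i to i + 1. *)
have pF0 : Dplus P W i j = 0.
  apply/eqP; rewrite mulf_eq0 subr_eq0; apply/orP; left.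
  rewrite eq_le; apply/andP; split; last by apply: Whomo; rewrite inordK.
  by rewrite WVk; apply: Wle; rewrite inordK.
have pB0 : 0 <= Dminus P W i j.
  rewrite divr_ge0 ?(ltW dx0)// subr_ge0 Whomo// inordK ?leq_pred//.
  exact: leq_ltn_trans (leq_pred _) (ltn_ord i).
(* Since i <= k - 1, the minimizing property of k also covers k - 1. *)
have pBk : Dminus P V k j <= 0.
  rewrite ler_pdivrMr// mul0r subr_le0 kmin// inordK.
    by rewrite -ltnS prednK// (leq_ltn_trans _ ik).
  exact: leq_ltn_trans (leq_pred _) (ltn_ord k).
have c0e i' := cbar_lt hP hn i' j he.
have c0p i' := cbar_gt0 hP hn i' j.
(* At i the prices bound the Hamiltonian of W by this value; at k, consuming 1 / e against a
   nonpositive backward price attains at least this value. *)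
apply: (@le_trans _ _ (F (1 / e) (W i j))).
  have [c1 [c2 [[c1p c1c c2c _ _] c2e -> _]]] :=
    Hreg_argmax hP hn i j (Dplus P W i j) (Dminus P W i j) he w0.
  rewrite pF0 /control_gain /gain mulr0 add0r.
  have := aggregator_homo_c hP (W i j) c1p c1c.
  have := aggregator_homo_c hP (W i j) (lt_le_trans (c0p i) c2c) c2e.
  have : (c0 i j - c2) * Dminus P W i j <= 0.
    by rewrite mulr_le0_ge0// subr_le0.
  lra.
have vk0 := below_Vhigh_lt0 k j VVh.
have [_ [_ [_ _ _ hmax]]] :=
  Hreg_argmax hP hn k j (Dplus P V k j) (Dminus P V k j) he vk0.
have hc : control P k j (c0 k j) (1 / e).
  split=> //; first exact: ltW.
  by move=> k0; move: ik; rewrite k0.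
apply: le_trans (hmax _ _ hc (lexx _)).
rewrite /control_gain gain_cbar /gain WVk.
have : 0 <= (c0 k j - 1 / e) * Dminus P V k j.
  by rewrite mulr_le0// subr_le0 ltW.
lra.
Qed.

End MinimalSolutions.

(** * Passage to the limit *)

Section Convergence.

Lemma cvg_mx_entry (R : realType) (T : Type) (m k : nat) (G : set_system T)
    (FG : Filter G) (f : T -> 'M[R]_(m.+1, k.+1)) (A : 'M[R]_(m.+1, k.+1)) :
  (forall i j, f t i j @[t --> G] --> A i j) -> f t @[t --> G] --> A.
Proof.
move=> fA; apply/cvg_ballP => eps eps0.
have : \forall t \near G, forall i j, ball (A i j) eps (f t i j).
  apply: filter_forall => i; apply: filter_forall => j.
  by have /cvg_ballP /(_ _ eps0) := fA i j.
by apply: filterS => t ft; split.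
Qed.

Lemma powR_continuous (R : realType) (x a : R) : 0 < a ->
  {for a, continuous (fun b : R => b `^ x)}.
Proof.
move=> a0; apply: differentiable_continuous; apply/derivable1_diffP.
by apply: derivable_powR; rewrite in_itv /= a0.
Qed.

Variables (R : realType) (P : params R) (n : nat).
Hypothesis hP : standing P.
Hypothesis hn : (0 < n)%N.
Hypothesis htheta : 0 < theta P /\ theta P < 1.
Variables (Veps : R -> 'M[R]_(n.+1, 2)) (Vs : 'M[R]_(n.+1, 2)).
Hypothesis Veps_min : forall e, admissible P e ->
  minimal_solution P (systemR P e) (Veps e).
Hypothesis Veps_cvg : forall i j, Veps e i j @[e --> 0^'+] --> Vs i j.
Hypothesis Veps_le : forall e, admissible P e -> preceq (Veps e) Vs.
Implicit Types (v p c e M : R) (V W : 'M[R]_(n.+1, 2)) (i : 'I_n.+1) (j : 'I_2).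

Local Notation rho := (rho P).
Local Notation theta := (theta P).
Local Notation F := (aggregator P).
Local Notation c0 i j := (cbar P j (xgrid P i)).
Local Notation dx := (dx P n).
Local Notation gain_at V i j :=
  (control_gain P i j (V i j) (Dplus P V i j) (Dminus P V i j)).

Let C0 := rate P * xmax P + income P ord_max.

Lemma max_cbar_gt0 : 0 < C0.
Proof.
rewrite addr_gt0// ?mulr_gt0 ?(rate_gt0 hP) ?(xmax_gt0 hP)//.
exact: lt_trans (income1_gt0 hP) (income1_lt2 hP).
Qed.

Lemma admissibleE e : admissible P e <-> 0 < e < C0^-1.
Proof.
rewrite /admissible -/C0; split.
  by move=> [e0 h]; rewrite e0 -[e]invrK ltf_pV2 ?posrE ?invr_gt0 ?max_cbar_gt0// -div1r.
move=> /andP[e0 h]; split=> //; rewrite div1r -[C0]invrK ltf_pV2 ?posrE//.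
by rewrite invr_gt0 max_cbar_gt0.
Qed.

Lemma near_admissible : \forall e \near 0^'+, admissible P e.
Proof.
near=> e; apply/admissibleE; apply/andP; split; near: e.
  exact: nbhs_right_gt.
by apply: nbhs_right_lt; rewrite invr_gt0 max_cbar_gt0.
Unshelve. all: by end_near. Qed.

Lemma limit_le_Vhigh : preceq Vs (Vhigh P n).
Proof.
move=> i j; apply: (cvgr_to_le (@Veps_cvg i j)).
by apply: filterS near_admissible => e /Veps_min[[_ _ h] _]; exact: h.
Qed.

Lemma limit_lt0 i j : Vs i j < 0.
Proof. exact: below_Vhigh_lt0 limit_le_Vhigh. Qed.

Lemma limit_ge_Ulow : preceq (Ulow P n) Vs.
Proof.
move=> i j; apply: (cvgr_to_ge (@Veps_cvg i j)).
by apply: filterS near_admissible => e /Veps_min[[_ h _] _]; exact: h.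
Qed.

Lemma Dplus_cvg i j : Dplus P (Veps e) i j @[e --> 0^'+] --> Dplus P Vs i j.
Proof. by apply: cvgMl; apply: cvgB; exact: Veps_cvg. Qed.

Lemma Dminus_cvg i j : Dminus P (Veps e) i j @[e --> 0^'+] --> Dminus P Vs i j.
Proof. by apply: cvgMl; apply: cvgB; exact: Veps_cvg. Qed.

Lemma aggregator_cvg c i j : F c (Veps e i j) @[e --> 0^'+] --> F c (Vs i j).
Proof.
apply: cvgMr.
apply: (@continuous_cvg _ _ _ _ _ (fun e => (1 - gamma P) * Veps e i j : R)
  (fun a : R => a `^ (1 - theta)) ((1 - gamma P) * Vs i j : R)).
  by apply: powR_continuous; exact: scaled_gt0 (limit_lt0 i j).
by apply: cvgMr; exact: Veps_cvg.
Qed.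

Lemma gain_at_cvg i j c1 c2 :
  gain_at (Veps e) i j c1 c2 @[e --> 0^'+] --> gain_at Vs i j c1 c2.
Proof.
apply: cvgB; last exact: aggregator_cvg.
apply: cvgD; apply: cvgD; try exact: aggregator_cvg.
  by apply: cvgMr; exact: Dplus_cvg.
by apply: cvgMr; exact: Dminus_cvg.
Qed.

Lemma residual_cvg i j :
  residual P (Veps e) i j @[e --> 0^'+] --> residual P Vs i j.
Proof.
apply: cvgB; apply: cvgMr; first exact: Veps_cvg.
by apply: cvgB; exact: Veps_cvg.
Qed.

(** A fixed c2 satisfies [c2 <= 1 / e] for all small e, so the inequality for [Veps e] passes to the
    limit. *)
Lemma limit_super i j c1 c2 : control P i j c1 c2 ->
  gain_at Vs i j c1 c2 <= residual P Vs i j.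
Proof.
move=> hc; apply: (ler_cvg_to (@gain_at_cvg i j c1 c2) (@residual_cvg i j)).
have c2p : 0 < c2 by case: hc => _ _ h _ _; exact: lt_le_trans (cbar_gt0 hP hn i j) h.
near=> e.
have he : admissible P e by near: e; exact: near_admissible.
have c2e : c2 <= 1 / e.
  rewrite ler_pdivlMr; last by case: he.
  rewrite mulrC -ler_pdivlMr// div1r ltW//; near: e.
  by apply: nbhs_right_lt; rewrite invr_gt0.
have [[/systemRE VR _ VVh] _] := Veps_min he.
have v0 := below_Vhigh_lt0 hP hn i j VVh.
rewrite -VR; have [_ [_ [_ _ _ hmax]]] :=
  Hreg_argmax hP hn i j (Dplus P (Veps e) i j) (Dminus P (Veps e) i j) he v0.
exact: hmax.
Unshelve. all: by end_near. Qed.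

(** A positive limit quotient is handled by convergence; otherwise the left side is nonpositive, and
    monotonicity in wealth makes the right side nonnegative. *)
Lemma limit_Dminus_ge eta i j : 0 < eta -> eta < 1 ->
  \forall e \near 0^'+, (1 - eta) * Dminus P Vs i j <= Dminus P (Veps e) i j.
Proof.
move=> eta0 eta1; have dx0 := dx_gt0 hP hn.
have pred_le : ((inord i.-1 : 'I_n.+1) <= i)%N.
  by rewrite inordK ?leq_pred// (leq_ltn_trans (leq_pred _)).
have [p0|p0] := leP (Dminus P Vs i j) 0.
  apply: filterS near_admissible => e he; apply: (@le_trans _ _ 0).
    by rewrite mulr_ge0_le0// subr_ge0 ltW.
  rewrite divr_ge0 ?(ltW dx0)// subr_ge0.
  exact: minimal_solutionR_homo (Veps_min he) pred_le.
have lt : (1 - eta) * Dminus P Vs i j < Dminus P Vs i j.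
  by rewrite gtr_pMl// gtrBl.
by apply: filterS (cvgr_gt _ (@Dminus_cvg i j) _ lt) => e /ltW.
Qed.

(* The optimal c2 of the regularized problem may tend to infinity, so its gain
   is compared at the price (1 - eta) * D^-: being affine in the price, it is a
   convex combination of the gains at the prices D^- and 0. *)
Lemma limit_sub i j G :
  (forall c1 c2, control P i j c1 c2 -> gain_at Vs i j c1 c2 <= G) ->
  residual P Vs i j <= G.
Proof.
move=> hG; have dx0 := dx_gt0 hP hn; have vs0 := limit_lt0 i j.
have cp := cbar_gt0 hP hn i j.
have A0 := aggregator_lt0 hP cp vs0; set A := F _ _ in A0.
suff key eta : 0 < eta -> eta < 1 -> residual P Vs i j <= G - eta * A.
  apply/ler_addgt0Pr => d d0; have dA0 : 0 < d - A by lra.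
  (* With eta = d / (d - A) and A < 0, the error - eta * A is at most d. *)
  apply: (@le_trans _ _ (G - d / (d - A) * A)).
    by apply: key; [rewrite divr_gt0 | rewrite ltr_pdivrMr// mul1r; lra].
  rewrite lerD2l -mulrN mulrAC ler_pdivrMr// ler_pM2l//; lra.
move=> eta0 eta1.
have rhs_cvg : G - eta * A + c0 i j * ((Vs i j - Veps e i j) / dx) @[e --> 0^'+] -->
    G - eta * A + c0 i j * ((Vs i j - Vs i j) / dx).
  apply: cvgD; first exact: cvg_cst.
  apply: cvgMr; apply: cvgMl; apply: cvgB; [exact: cvg_cst | exact: Veps_cvg].
(* The added zero is the limit of the forward-quotient error in [rhs_cvg]. *)
rewrite -[leRHS]addr0 -(mulr0 (c0 i j)) -(mul0r dx^-1) -(subrr (Vs i j)).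
apply: (ler_cvg_to (@residual_cvg i j) rhs_cvg).
near=> e.
have he : admissible P e by near: e; exact: near_admissible.
have [[/systemRE VR _ VVh] _] := Veps_min he.
have v0 := below_Vhigh_lt0 hP hn i j VVh.
have pB : (1 - eta) * Dminus P Vs i j <= Dminus P (Veps e) i j.
  by near: e; exact: limit_Dminus_ge.
rewrite -VR; have [c1 [c2 [hc c2e -> _]]] :=
  Hreg_argmax hP hn i j (Dplus P (Veps e) i j) (Dminus P (Veps e) i j) he v0.
have [c1p c1c c2c hM h0] := hc.
have c2p := lt_le_trans cp c2c.
have VVs := Veps_le he.
have G1 := aggregator_diff_homo_v hP htheta c1p c1c (VVs i j) vs0.
have G2 := aggregator_homo_v hP htheta c2p (VVs i j) vs0.
have G3 := aggregator_lt0 hP c2p vs0.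
(* This control bounds the price-0 share of the convex combination; as F at c2 is negative, only -
   eta * A is lost. *)
have hc' : control P i j c1 (c0 i j) by split.
have := hG _ _ hc; have := hG _ _ hc'; rewrite /control_gain gain_cbar /gain.
(* [Veps e] is below [Vs] at i + 1, so its forward quotient exceeds the limit one by at most the gap
   at i over dx. *)
have pF : (c0 i j - c1) * Dplus P (Veps e) i j <=
    (c0 i j - c1) * Dplus P Vs i j + c0 i j * ((Vs i j - Veps e i j) / dx).
  apply: (@le_trans _ _ ((c0 i j - c1) * (Dplus P Vs i j + (Vs i j - Veps e i j) / dx))).
    rewrite ler_wpM2l ?subr_ge0// /Dplus -mulrDl ler_pM2r ?invr_gt0//.
    by have := VVs (inord i.+1) j; lra.
  rewrite mulrDr lerD2l ler_wpM2r//; last lra.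
  by rewrite divr_ge0 ?(ltW dx0)// subr_ge0.
have pB' : (c0 i j - c2) * Dminus P (Veps e) i j <=
    (c0 i j - c2) * ((1 - eta) * Dminus P Vs i j).
  by rewrite ler_wnM2l// subr_le0.
rewrite -/A; set X := (c0 i j - c1) * Dplus P Vs i j in pF *.
set Y := (c0 i j - c2) * Dminus P Vs i j.
have EY : (c0 i j - c2) * ((1 - eta) * Dminus P Vs i j) = (1 - eta) * Y.
  by rewrite /Y; ring.
rewrite EY in pB'.
set F2 := F c2 (Vs i j) in G2 G3 *; set F1 := F c1 (Vs i j) in G1 *.
move=> g1 g2.
have h2 : (1 - eta) * (X + F1 + (Y + F2) - A) <= (1 - eta) * G.
  by rewrite ler_pM2l// subr_gt0.
have h1 : eta * (X + F1 + A - A) <= eta * G by rewrite ler_pM2l.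
have h3 : eta * F2 <= 0 by rewrite mulr_ge0_le0 ?ltW.
rewrite -/A in G1; lra.
Unshelve. all: by end_near. Qed.

Lemma limit_minimal_solution : minimal_solution P (@systemD R P n) Vs.
Proof.
split.
  split; [apply/systemDE => i j | exact: limit_ge_Ulow | exact: limit_le_Vhigh].
  have vs0 := limit_lt0 i j.
  have hle := Hbold_le hP hn vs0 (@limit_super i j).
  have hge c1 c2 (hc : control P i j c1 c2) :=
    Hbold_ge hP hn (Dplus P Vs i j) (Dminus P Vs i j) vs0 hc.
  apply/eqP; rewrite eq_le hle /=; move: hle hge.
  (* The bound [hle] excludes +oo, and the zero-drift control excludes -oo. *)
  case: Hbold => [G| |] // _ hge.
    by rewrite lee_fin; apply: limit_sub => c1 c2 /hge; rewrite lee_fin.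
  by have := hge _ _ (control_cbar hP hn i j).
(* A solution of (D) is a supersolution of every regularized system, so it bounds each [Veps e] and
   hence the limit. *)
move=> W [/systemDE WD UW WV] i j.
apply: (cvgr_to_le (@Veps_cvg i j)).
apply: filterS near_admissible => e he.
apply: (minimal_solutionR_le hP hn htheta he (Veps_min he)) => // {}i {}j.
have w0 := below_Vhigh_lt0 hP hn i j WV.
have [c1 [c2 [hc _ -> _]]] :=
  Hreg_argmax hP hn i j (Dplus P W i j) (Dminus P W i j) he w0.
by rewrite -lee_fin -WD; exact: Hbold_ge.
Qed.

End Convergence.

Theorem proposition5p10 (R : realType) (P : params R) (n : nat)
    (hP : standing P) (hn : (0 < n)%N)
    (htheta : 0 < theta P /\ theta P < 1) :
  (forall e : R, admissible P e ->
     exists V : 'M[R]_(n.+1, 2), minimal_solution P (systemR P e) V) /\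
  (forall Veps : R -> 'M[R]_(n.+1, 2),
     (forall e : R, admissible P e ->
        minimal_solution P (systemR P e) (Veps e)) ->
     (forall e e' : R, admissible P e -> 0 < e' -> e' < e ->
        preceq (Veps e) (Veps e')) /\
     (exists V : 'M[R]_(n.+1, 2),
        minimal_solution P (@systemD R P n) V /\
        Veps e @[e --> 0^'+] --> V)).
Proof.
split=> [e he|Veps hV].
  by have [V [hV _]] := minimal_solutionR_exists hP hn htheta he; exists V.
have anti e e' : admissible P e -> 0 < e' -> e' < e -> preceq (Veps e) (Veps e').
  move=> he e'0 e'e.
  exact: (minimal_solutionR_anti hP hn htheta he e'0 e'e (hV _ he)
    (hV _ (admissible_lt he e'0 e'e))).
split=> //.
set E0 := (rate P * xmax P + income P ord_max)^-1.
have E0_gt0 : 0 < E0 by rewrite invr_gt0 max_cbar_gt0.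
have admE e : e \in `]0, E0[ -> admissible P e.
  by rewrite in_itv => h; apply/(admissibleE hP).
pose S i j := [set Veps e i j | e in [set` `]0, E0[]].
have ubS i j : ubound (S i j) (Vhigh P n i j).
  by move=> _ [e /= /admE/hV[[_ _ h] _] <-]; exact: h.
(* Each entry is monotone in e and bounded by the upper barrier, so its right limit at 0 is its
   supremum. *)
pose Vs : 'M[R]_(n.+1, 2) := \matrix_(i, j) sup (S i j).
have Vcvg i j : Veps e i j @[e --> 0^'+] --> Vs i j.
  rewrite mxE; apply: nonincreasing_at_right_cvgr => //.
    move=> e e' he he'; rewrite le_eqVlt => /predU1P[->//|ee'].
    apply: (anti e' e) => //; first exact: admE.
    by move: he; rewrite in_itv => /andP[].
  by exists (Vhigh P n i j); exact: ubS.
have Vle e : admissible P e -> preceq (Veps e) Vs.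
  move=> /(admissibleE hP) he i j; rewrite mxE; apply: ub_le_sup.
    by exists (Vhigh P n i j); exact: ubS.
  by exists e => //=; rewrite in_itv.
exists Vs; split; last exact: cvg_mx_entry.
exact: (limit_minimal_solution hP hn htheta hV Vcvg Vle).
Qed.
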